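(* Let $x:[t_0,+\infty)\to\mathcal H$ be a solution trajectory of $$\dot x(t)+\frac{d}{dt}\Phi_t(x(t))+\Phi_t(x(t))=0,\qquad \Phi_t(z):=V(z)+\varepsilon(t)\nabla h(z),\quad \varepsilon(t)=\frac c{t^\delta},$$ and let $x^*$ be an optimal solution of the problem of minimizing $h(x)$ subject to $V(x)=0$. Fix $0<\lambda<\frac1\delta$ and let $$\zeta_2(t):=\varepsilon(t)-\ddot\varepsilon(t)+\lambda\bigl(\varepsilon(t)-\dot\varepsilon(t)-t\ddot\varepsilon(t)\bigr),$$ which has the same asymptotic order as $\varepsilon(t)$ as $t\to+\infty$. For every $t\ge t_0$ for which the denominator below is nonzero, define $$\bar x_t:=\frac1{\int_{t_0}^t\zeta_2(s)\,ds}\int_{t_0}^t\zeta_2(s)x(s)\,ds,\qquad x_t^{\mathrm{best}}\in\operatorname*{argmin}_{z\in\{x(t),\bar x_t\}}h(z).$$ Then, as $t\to+\infty$: (a) $\|\Phi_t(x(t))\|$ is $\mathcal O\left(\frac1{\sqrt t}\right)$ if $\delta>1$, $\mathcal O\left(\sqrt{\frac{\ln t}{t}}\right)$ if $\delta=1$, and $\mathcal O\left(\frac1{t^{\delta/2}}\right)$ if $0<\delta<1$. (b) $\frac1t\int_{t_0}^t\langle x(s)-x^*,V(x(s))\rangle\,ds$ is $\mathcal O\left(\frac1t\right)$ if $\delta>1$, $\mathcal O\left(\frac{\ln t}t\right)$ if $\delta=1$, and $\mathcal O\left(\frac1{t^\delta}\right)$ if $0<\delta<1$. (c) $h(x_t^{\mathrm{best}})-h(x^*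 )\le\mathcal O\left(\frac1{\ln t}\right)$ if $\delta=1$, and $h(x_t^{\mathrm{best}})-h(x^* )\le\mathcal O\left(\frac1{t^{1-\delta}}\right)$ if $0<\delta<1$. Here $\le\mathcal O(r(t))$ means that only an upper bound is asserted for a quantity that has no definite sign: there are $C\ge0$ and $T>t_0$ such that the quantity is at most $C\,r(t)$ for all $t\ge T$. (No rate is asserted for this quantity when $\delta>1$.)
   Context: $\mathcal H$ is a real Hilbert space. $h:\mathcal H\to\mathbb R$ is convex, continuously Fréchet differentiable and bounded below, and $\nabla h$ is bounded on bounded subsets of $\mathcal H$. $V:\mathcal H\to\mathcal H$ is continuous and monotone ($\langle V(x)-V(y),x-y\rangle\ge0$ for all $x,y$). An optimal solution of the bilevel problem is a point $x^*$ with $V(x^* )=0$ and $h(x^* )\le h(x)$ for all $x$ with $V(x)=0$. Constants $c,\delta,t_0>0$ are fixed. A solution trajectory is a map $x:[t_0,+\infty)\to\mathcal H$ such that $x$ and $t\mapsto\Phi_t(x(t))$ are differentiable on $[t_0,+\infty)$ (one-sided at $t_0$) and the differential equation holds for every $t\ge t_0$. Dots denote derivatives in $t$. *)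

(* Defs.v *)
From Stdlib Require Import Reals.
From Coquelicot Require Import Coquelicot.

Set Implicit Arguments.
Unset Strict Implicit.
Unset Printing Implicit Defensive.

Local Open Scope R_scope.

(* Definiteness of [inner] comes from [inner_norm] and the norm axioms of the
   carrier; Coquelicot's balls are equivalent to the norm balls, so
   completeness of the carrier is completeness for the norm. *)
Record RealHilbert : Type := {
  hilbert_space :> CompleteNormedModule R_AbsRing;
  inner : hilbert_space -> hilbert_space -> R;
  inner_sym : forall u v, inner u v = inner v u;
  inner_plus_l : forall u v w, inner (plus u v) w = inner u w + inner v w;
  inner_scal_l : forall (a : R) u v, inner (scal a u) v = a * inner u v;
  inner_norm : forall u, norm u = sqrt (inner u u)
}.

Definition convex_fun (H : RealHilbert) (h : H -> R) : Prop :=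
  forall (u v : H) (a : R), 0 <= a <= 1 ->
    h (plus (scal a u) (scal (1 - a) v)) <= a * h u + (1 - a) * h v.

Definition bounded_below (H : RealHilbert) (h : H -> R) : Prop :=
  exists m : R, forall z : H, m <= h z.

Definition is_gradient (H : RealHilbert) (h : H -> R) (z g : H) : Prop :=
  filterdiff h (locally z) (fun v : H => inner g v).

Definition bounded_set (H : RealHilbert) (S : H -> Prop) : Prop :=
  exists M : R, forall z : H, S z -> norm z <= M.

Definition bounded_on_bounded (H : RealHilbert) (F : H -> H) : Prop :=
  forall S : H -> Prop, bounded_set S ->
    bounded_set (fun y : H => exists z : H, S z /\ y = F z).

Definition monotone_op (H : RealHilbert) (V : H -> H) : Prop :=
  forall u v : H, 0 <= inner (minus (V u) (V v)) (minus u v).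

Definition is_argmin (T : Type) (S : T -> Prop) (f : T -> R) (z : T) : Prop :=
  S z /\ forall y : T, S y -> f z <= f y.

Definition optimal_solution (H : RealHilbert) (V : H -> H) (h : H -> R)
    (xs : H) : Prop :=
  is_argmin (fun z : H => V z = zero) h xs.

(* Derivative at [t] along [t0, +oo): two-sided for [t0 < t], one-sided at
   [t0]. Values of [f] before [t0] play no role. *)
Definition is_derive_from (H : RealHilbert) (t0 : R) (f : R -> H) (t : R)
    (l : H) : Prop :=
  filterdiff f (within (fun s : R => t0 <= s) (locally t))
    (fun s : R => scal s l).

Definition eps (c delta t : R) : R := c / Rpower t delta.

Definition Phi (H : RealHilbert) (V gradh : H -> H) (c delta : R)
    (t : R) (z : H) : H :=
  plus (V z) (scal (eps c delta t) (gradh z)).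

Definition solution_trajectory (H : RealHilbert) (V gradh : H -> H)
    (c delta t0 : R) (x : R -> H) : Prop :=
  forall t : R, t0 <= t ->
    exists dx dPhi : H,
      is_derive_from t0 x t dx /\
      is_derive_from t0 (fun s : R => Phi V gradh c delta s (x s)) t dPhi /\
      plus (plus dx dPhi) (Phi V gradh c delta t (x t)) = zero.

Definition zeta2 (c delta lambda t : R) : R :=
  eps c delta t - Derive_n (eps c delta) 2 t
  + lambda * (eps c delta t - Derive (eps c delta) t
              - t * Derive_n (eps c delta) 2 t).

Definition zeta2_int (c delta lambda t0 t : R) : R :=
  RInt (zeta2 c delta lambda) t0 t.

Definition xbar (H : RealHilbert) (c delta lambda t0 : R) (x : R -> H)
    (t : R) : H :=
  scal (1 / zeta2_int c delta lambda t0 t)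
    (RInt (fun s : R => scal (zeta2 c delta lambda s) (x s)) t0 t).

Definition bigO (f g : R -> R) : Prop :=
  exists C : R, 0 <= C /\
    Rbar_locally p_infty (fun t : R => Rabs (f t) <= C * Rabs (g t)).

Definition same_order (f g : R -> R) : Prop := bigO f g /\ bigO g f.

(* One-sided version of [bigO], for quantities without a definite sign. *)
Definition upper_bigO (t0 : R) (f g : R -> R) : Prop :=
  exists C T : R, 0 <= C /\ t0 < T /\
    forall t : R, T <= t -> f t <= C * g t.

(* Main.v *)
Require Import Defs.
From Stdlib Require Import Reals Lra.
From Coquelicot Require Import Coquelicot.

Local Open Scope R_scope.

(** Write [w t] for the residual [Phi t (x t)], [y] for [x + w - xs] and [g] for
    the value gap [h (x t) - h xs]. The differential equation says [y' = - w].
    Three inequalities drive the proof: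
    - monotonicity of [Phi t], differentiated along the trajectory through
      difference quotients, gives [<w', x'> >= eps' g'], hence
      [(|w|^2 / 2)' <= - eps' g'];
    - the gradient inequality for [h] gives
      [<x - xs, w> >= <x - xs, V x> + eps g];
    - the same inequality and the equation for [y] give [eps g <= |y|^2 / 4].

    By the first two, the energy
      [(1 + lambda) / 2 |y|^2 + (1 + lambda t) (|w|^2 / 2 + eps' g)]
    has derivative at most [- (1 + lambda) <x - xs, V x> - zeta2 g]
    ([energy_derive]); the choice of [zeta2] is dictated by this computation. By
    the third, and because [lambda delta < 1], the energy eventually dominates
    [lambda t |w|^2 / 2] ([energy_lower]). Integrating ([energy_balance]) yields
    two kinds of information.

    Since [h] is bounded below, [- zeta2 g] is at most a constant times [eps], so
    [t |w|^2] and the integral of [<x - xs, V x>] grow no faster than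
    a constant plus a multiple of the primitive [Theta] of [eps]
    ([dissipation_bound]). As [Theta] is bounded above, logarithmic or of order
    [t^(1 - delta)] according to the position of [delta] with respect to one,
    this gives the rates for the residual and for the averaged pairing.

    The integral of [zeta2 g] itself is bounded above by the energy at a fixed
    time. When [Theta] is unbounded, Jensen's inequality then bounds the value at
    the weighted mean by a constant over the total weight, which is at least of
    order [Theta]
    ([value_bound]). The weight [zeta2] may be negative for small [t]; the
    initial part of the integral is treated as a single point, taken long
    enough for its total weight to be positive ([ergodic_convexity]). *)

(** * Inner product, gradients and derivatives along curves *)

Section Inner.
Context {H : RealHilbert}.
Implicit Types u v w z : H.

Lemma inner_plus_r u v w : inner u (plus v w) = inner u v + inner u w.
Proof. now rewrite inner_sym, inner_plus_l, 2!(inner_sym _ u). Qed.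

Lemma inner_scal_r (a : R) u v : inner u (scal a v) = a * inner u v.
Proof. now rewrite inner_sym, inner_scal_l, inner_sym. Qed.

Lemma inner_opp_l u v : inner (opp u) v = - inner u v.
Proof.
  replace (opp u) with (scal (-1) u) by exact (scal_opp_one u).
  rewrite inner_scal_l. ring.
Qed.

Lemma inner_opp_r u v : inner u (opp v) = - inner u v.
Proof. now rewrite inner_sym, inner_opp_l, inner_sym. Qed.

Lemma inner_minus_l u v w : inner (minus u v) w = inner u w - inner v w.
Proof. unfold minus. rewrite inner_plus_l, inner_opp_l. ring. Qed.

Lemma inner_minus_r u v w : inner u (minus v w) = inner u v - inner u w.
Proof. unfold minus. rewrite inner_plus_r, inner_opp_r. ring. Qed.

Lemma inner_zero_l v : inner zero v = 0.
Proof.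
  replace (zero : H) with (scal 0 v) by exact (scal_zero_l v).
  rewrite inner_scal_l. ring.
Qed.

Lemma inner_zero_r v : inner v zero = 0.
Proof. now rewrite inner_sym, inner_zero_l. Qed.

Lemma norm_zero_eq u : norm u = 0 -> u = zero.
Proof. exact (norm_eq_zero u). Qed.

(** If [inner u u] were negative, the truncated square root would make the
    norm of [u] vanish, hence [u = zero] and [inner u u = 0]. *)
Lemma inner_pos u : 0 <= inner u u.
Proof.
  destruct (Rle_lt_dec 0 (inner u u)) as [h|h]; [exact h|].
  assert (u0 : u = zero).
  { apply norm_zero_eq. rewrite inner_norm. apply sqrt_neg_0. lra. }
  rewrite u0, inner_zero_l. lra.
Qed.

Lemma norm_sqr u : norm u * norm u = inner u u.
Proof. rewrite inner_norm. apply sqrt_def, inner_pos. Qed.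

(** Vector identities are reduced to identities between real numbers, where
    [ring] and [field] apply. *)
Lemma inner_ext u v : (forall w, inner u w = inner v w) -> u = v.
Proof.
  intros e.
  assert (d0 : minus u v = zero).
  { apply norm_zero_eq. rewrite inner_norm, inner_minus_l, e.
    rewrite Rminus_diag. apply sqrt_0. }
  refine (plus_reg_r (opp v) u v _).
  rewrite (plus_opp_r v). exact d0.
Qed.

(** The square of [|v| u -+ |u| v] is nonnegative. *)
Lemma cauchy_schwarz u v : Rabs (inner u v) <= norm u * norm v.
Proof.
  assert (q : forall a b : R,
    0 <= a * a * inner u u - 2 * a * b * inner u v + b * b * inner v v).
  { intros a b. generalize (inner_pos (minus (scal a u) (scal b v))).
    rewrite !inner_minus_l, !inner_minus_r, !inner_scal_l, !inner_scal_r.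
    rewrite (inner_sym v u). intros p. eapply Rle_trans; [exact p|]. right. ring. }
  assert (pu := norm_ge_0 u). assert (pv := norm_ge_0 v).
  destruct (Req_dec (norm u) 0) as [zu|zu].
  { rewrite (norm_zero_eq u zu), inner_zero_l, Rabs_R0.
    apply Rmult_le_pos; [exact (norm_ge_0 zero)|exact pv]. }
  destruct (Req_dec (norm v) 0) as [zv|zv].
  { rewrite (norm_zero_eq v zv), inner_zero_r, Rabs_R0.
    apply Rmult_le_pos; [exact pu|exact (norm_ge_0 zero)]. }
  assert (q1 := q (norm v) (norm u)). assert (q2 := q (norm v) (- norm u)).
  rewrite <- !norm_sqr in q1, q2.
  assert (0 < norm u * norm v) by nra.
  apply Rabs_le. split; nra.
Qed.

Lemma is_linear_inner v : is_linear (fun u : H => inner v u).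
Proof.
  split.
  - intros; apply inner_plus_r.
  - intros; apply inner_scal_r.
  - exists (norm v + 1). split.
    + generalize (norm_ge_0 v); lra.
    + intros u. eapply Rle_trans; [apply cauchy_schwarz|].
      generalize (norm_ge_0 u); nra.
Qed.

(** The remainder of the first order expansion at [z] is exactly the square of
    the norm of the increment. *)
Lemma is_gradient_sqnorm z :
  is_gradient (fun u : H => inner u u) z (scal 2 z).
Proof.
  split.
  - exact (is_linear_inner (scal 2 z)).
  - intros z' hz'.
    assert (ez : z = z')
      by exact (is_filter_lim_locally_unique (K := R_AbsRing) (V := H) z z' hz').
    subst z'.
    intros e.
    assert (n : locally_norm z (fun u : H => norm (minus u z) < e)).
    { exists e. intros u hu. exact hu. }
    apply locally_le_locally_norm in n.
    revert n; apply filter_imp. intros u hu.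
    change (Rabs (inner u u - inner z z - inner (scal 2 z) (minus u z))
              <= e * norm (minus u z)).
    replace (inner u u - inner z z - inner (scal 2 z) (minus u z))
      with (norm (minus u z) * norm (minus u z)).
    + assert (p : 0 <= norm (minus u z)) by exact (norm_ge_0 (minus u z)).
      rewrite Rabs_pos_eq by (apply Rmult_le_pos; exact p).
      apply Rmult_le_compat_r; [exact p|left; exact hu].
    + rewrite norm_sqr, inner_scal_l, !inner_minus_l, !inner_minus_r, (inner_sym u z). ring.
Qed.

(** By polarization, from the continuity of the square of the norm. *)
Lemma filterlim_inner {T} {F : (T -> Prop) -> Prop} {FF : Filter F}
    (f g : T -> H) u v :
  filterlim f F (locally u) -> filterlim g F (locally v) ->
  filterlim (fun s => inner (f s) (g s)) F (locally (inner u v)).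
Proof.
  intros hf hg.
  assert (q : forall (k : T -> H) z, filterlim k F (locally z) ->
    filterlim (fun s => inner (k s) (k s)) F (locally (inner z z))).
  { intros k z hk.
    refine (filterlim_comp _ _ _ k (fun u : H => inner u u) F _ _ hk _).
    apply (filterdiff_continuous (V := R_NormedModule) (fun u : H => inner u u)).
    eexists; apply is_gradient_sqnorm. }
  assert (qs := q _ _ (filterlim_comp_2 _ _ _ hf hg (filterlim_plus (K := R_AbsRing) (V := H) u v))).
  assert (m : filterlim (fun s => minus (f s) (g s)) F (locally (minus u v))).
  { unfold minus. eapply filterlim_comp_2; [exact hf| |].
    2: exact (filterlim_plus (K := R_AbsRing) (V := H) u (opp v)).
    refine (filterlim_comp _ _ _ g opp F _ _ hg _).
    exact (filterlim_opp (K := R_AbsRing) (V := H) v). }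
  assert (qd := q _ _ m).
  set (polar := fun a b : H => scal (/4)
    (plus (inner (plus a b) (plus a b)) (opp (inner (minus a b) (minus a b))))).
  assert (l : filterlim (fun s => polar (f s) (g s)) F (locally (polar u v))).
  { refine (filterlim_comp _ _ _ _ (scal (/4)) F _ _ _ _);
      [|apply (filterlim_scal_r (V := R_NormedModule))].
    refine (filterlim_comp_2 _ _ _ qs _ (filterlim_plus (V:=R_NormedModule) _ _)).
    refine (filterlim_comp _ _ _ _ opp F _ _ qd _).
    apply (filterlim_opp (V := R_NormedModule)). }
  assert (e : forall a b : H, polar a b = inner a b).
  { intros a b.
    change (/4 * (inner (plus a b) (plus a b) + - inner (minus a b) (minus a b))
      = inner a b).
    rewrite !inner_minus_l, !inner_minus_r, !inner_plus_l, !inner_plus_r, (inner_sym b a). field. }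
  rewrite e in l. revert l. apply filterlim_ext. intros s. apply e.
Qed.

Lemma continuous_inner {U : UniformSpace} (f g : U -> H) (s : U) :
  continuous f s -> continuous g s -> continuous (fun s => inner (f s) (g s)) s.
Proof. intros hf hg. exact (filterlim_inner f g _ _ hf hg). Qed.

Lemma is_derive_comp_gradient (F : H -> R) (f : R -> H) (t : R) (df g : H) :
  is_gradient F (f t) g -> is_derive f t df ->
  is_derive (fun s => F (f s)) t (inner g df).
Proof.
  intros hF hf.
  assert (k := filterdiff_comp' f F t _ _ hf hF).
  refine (filterdiff_ext_lin _ _ _ k _). intros s. apply inner_scal_r.
Qed.

Lemma is_derive_quotient (f : R -> H) (t : R) (df : H) :
  is_derive f t df ->
  filterlim (fun s => scal (/ (s - t)) (minus (f s) (f t)))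
    (locally' t) (locally df).
Proof.
  intros [_ hf]. specialize (hf t (fun P p => p)).
  apply (filterlim_locally_ball_norm (K := R_AbsRing) (U := H)). intros e.
  assert (e2 : 0 < e / 2) by (destruct e; simpl; lra).
  destruct (hf (mkposreal _ e2)) as [d hd]. exists d. intros s hs hst.
  specialize (hd s hs). simpl in hd.
  change (norm (minus (minus (f s) (f t)) (scal (s - t) df))
    <= e / 2 * Rabs (s - t)) in hd.
  change (norm (minus (scal (/ (s - t)) (minus (f s) (f t))) df) < e).
  assert (a : 0 < Rabs (s - t)) by (apply Rabs_pos_lt; lra).
  replace (minus (scal (/ (s - t)) (minus (f s) (f t))) df)
    with (scal (/ (s - t)) (minus (minus (f s) (f t)) (scal (s - t) df))).
  - eapply Rle_lt_trans; [exact (norm_scal (/ (s - t)) _)|].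
    change (abs (/ (s - t))) with (Rabs (/ (s - t))). rewrite Rabs_inv.
    apply Rle_lt_trans with (/ Rabs (s - t) * (e / 2 * Rabs (s - t))).
    + apply Rmult_le_compat_l; [|exact hd]. left; now apply Rinv_0_lt_compat.
    + replace (/ Rabs (s - t) * (e / 2 * Rabs (s - t))) with (e / 2) by (field; lra).
      destruct e; simpl; lra.
  - apply inner_ext. intros w.
    rewrite inner_scal_l, !inner_minus_l, !inner_scal_l, inner_minus_l.
    field. lra.
Qed.

(** Nonnegativity of the bilinear difference quotient passes to the limit: this
    is how monotonicity of an operator becomes a differential inequality along
    a trajectory, without differentiating the operator. *)
Lemma inner_derivatives_ge (f g : R -> H) (e : R -> R) (t : R) (df dg u : H) (de : R) :
  is_derive f t df -> is_derive g t dg -> is_derive e t de ->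
  locally t (fun s =>
    (e s - e t) * inner u (minus (g s) (g t))
      <= inner (minus (f s) (f t)) (minus (g s) (g t))) ->
  de * inner u dg <= inner df dg.
Proof.
  intros hf hg he hm.
  assert (lf := is_derive_quotient f t df hf).
  assert (lg := is_derive_quotient g t dg hg).
  assert (le : filterlim (fun s => (e s - e t) / (s - t)) (locally' t) (locally de)).
  { apply is_derive_Reals in he. intros P [r hr].
    destruct (he r (cond_pos r)) as [d hd]. exists d. intros s hs hst.
    apply hr. specialize (hd (s - t)).
    replace (t + (s - t)) with (s : R) in hd by (simpl in *; ring). apply hd; [lra|exact hs]. }
  refine (filterlim_le (F := locally' t)
    (FF := Proper_StrongProper _ (Rbar_locally'_filter (Finite t)))
    (fun s => (e s - e t) / (s - t)
       * inner u (scal (/ (s - t)) (minus (g s) (g t))))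
    (fun s => inner (scal (/ (s - t)) (minus (f s) (f t)))
       (scal (/ (s - t)) (minus (g s) (g t))))
    (Finite (de * inner u dg)) (Finite (inner df dg)) _ _ _).
  - destruct hm as [d hd]. exists d. intros s hs hst. specialize (hd s hs).
    rewrite inner_scal_l, !inner_scal_r.
    replace ((e s - e t) / (s - t) * (/ (s - t) * inner u (minus (g s) (g t))))
      with (/ (s - t) * (/ (s - t) * ((e s - e t) * inner u (minus (g s) (g t)))))
      by (field; lra).
    rewrite <- !Rmult_assoc, !(Rmult_assoc (/ (s - t) * / (s - t))).
    apply Rmult_le_compat_l; [|exact hd]. apply Rle_0_sqr.
  - refine (filterlim_comp_2 _ _ Rmult le _ (filterlim_mult (K := R_AbsRing) _ _)).
    refine (filterlim_inner (fun _ => u) _ u dg _ lg). apply filterlim_const.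
  - exact (filterlim_inner _ _ df dg lf lg).
Qed.

(** A chord of a convex function lies above its graph, hence its slope bounds
    the directional derivative at its end from above. *)
Lemma convex_gradient_ineq (h : H -> R) (p g u : H) :
  convex_fun h -> is_gradient h p g ->
  h p + inner g (minus u p) <= h u.
Proof.
  intros hc hg. apply Rnot_lt_le. intros hlt.
  set (D := inner g (minus u p)) in *. set (m := h u - h p).
  assert (hd : is_derive (fun a : R => h (plus p (scal a (minus u p)))) 0 D).
  { apply is_derive_comp_gradient.
    - replace (plus p (scal 0 (minus u p))) with p; [exact hg|].
      apply inner_ext. intros w. rewrite inner_plus_l, inner_scal_l. ring.
    - split; [exact (is_linear_scal_l (V := H) (minus u p))|].
      intros a _ r. apply filter_forall. intros b.
      match goal with |- norm ?z <= _ => replace z with (zero : H) end.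
      + eapply Rle_trans; [right; exact (norm_zero (V := H))|].
        apply Rmult_le_pos; [left; apply cond_pos|].
        exact (norm_ge_0 (V := R_NormedModule) _).
      + apply inner_ext. intros w.
        rewrite inner_zero_l, !inner_minus_l, !inner_plus_l, !inner_scal_l.
        change (minus b a) with (b - a). ring. }
  apply is_derive_Reals in hd.
  destruct (hd (D - m)) as [d dd]; [unfold m; lra|].
  set (a := Rmin (d / 2) 1).
  assert (da := cond_pos d).
  assert (a0 : 0 < a) by (apply Rmin_pos; lra).
  assert (a1 : a <= 1) by apply Rmin_r.
  assert (a2 : a <= d / 2) by apply Rmin_l.
  specialize (dd a). rewrite Rplus_0_l in dd.
  assert (hD : Rabs ((h (plus p (scal a (minus u p)))
    - h (plus p (scal 0 (minus u p)))) / a - D) < D - m).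
  { apply dd; [lra|rewrite Rabs_pos_eq; lra]. }
  apply Rabs_def2 in hD.
  replace (plus p (scal 0 (minus u p))) with p in hD
    by (apply inner_ext; intros w; rewrite inner_plus_l, inner_scal_l; ring).
  replace (plus p (scal a (minus u p))) with (plus (scal a u) (scal (1 - a) p)) in hD
    by (apply inner_ext; intros w;
        rewrite !inner_plus_l, !inner_scal_l, inner_minus_l; ring).
  assert (hcc := hc u p a ltac:(lra)).
  assert ((h (plus (scal a u) (scal (1 - a) p)) - h p) / a <= m).
  { apply Rle_div_l; [exact a0|]. unfold m. lra. }
  lra.
Qed.

End Inner.

(** * The regularization parameter and the weight *)

Section Eps.
Variables c delta lambda : R.
Hypothesis c_pos : 0 < c.
Hypothesis delta_pos : 0 < delta.
Hypothesis lambda_pos : 0 < lambda.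

Lemma eps_pos t : 0 < eps c delta t.
Proof. apply Rdiv_lt_0_compat; [exact c_pos|apply exp_pos]. Qed.

Lemma is_derive_eps t :
  0 < t -> is_derive (eps c delta) t (- (delta / t) * eps c delta t).
Proof.
  intros ht. unfold eps, Rpower.
  assert (exp (delta * ln t) <> 0) by apply Rgt_not_eq, exp_pos.
  auto_derive; [easy|]. field. split; lra.
Qed.

Lemma is_derive_eps' t :
  0 < t -> is_derive (fun s => - (delta / s) * eps c delta s) t
    (delta * (delta + 1) / (t * t) * eps c delta t).
Proof.
  intros ht. assert (de := is_derive_eps t ht).
  auto_derive.
  - split; [lra|]. split; [|easy]. eexists; exact de.
  - change (fun s => eps c delta s) with (eps c delta).
    rewrite (is_derive_unique _ _ _ de). field. lra.
Qed.

Lemma zeta2_closed t :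
  0 < t ->
  zeta2 c delta lambda t
  = eps c delta t * (1 + lambda - lambda * (delta * delta) / t
                     - delta * (delta + 1) / (t * t)).
Proof.
  intros ht.
  assert (e2 : Derive_n (eps c delta) 2 t = delta * (delta + 1) / (t * t) * eps c delta t).
  { apply is_derive_unique. eapply is_derive_ext_loc; [|exact (is_derive_eps' t ht)].
    exists (mkposreal t ht). intros s hs. symmetry. apply is_derive_unique, is_derive_eps.
    apply Rabs_def2 in hs. unfold minus, plus, opp in hs. simpl in hs. lra. }
  unfold zeta2. rewrite e2, (is_derive_unique _ _ _ (is_derive_eps t ht)).
  field. lra.
Qed.

Lemma continuous_zeta2 t : 0 < t -> continuous (zeta2 c delta lambda) t.
Proof.
  intros ht. eapply continuous_ext_loc.
  - exists (mkposreal t ht). intros s hs. symmetry. apply zeta2_closed.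
    apply Rabs_def2 in hs. unfold minus, plus, opp in hs. simpl in hs. lra.
  - apply (ex_derive_continuous (V := R_NormedModule)).
    assert (de := is_derive_eps t ht). auto_derive.
    repeat split; try lra; try nra. eexists; exact de.
Qed.

(** The bracket in [zeta2_closed] tends to [1 + lambda]; for large [t] the two
    correction terms together are at most one half. *)
Lemma zeta2_bounds :
  exists T, 0 < T /\ forall t, T <= t ->
    (1 + lambda) / 2 * eps c delta t <= zeta2 c delta lambda t
      <= (1 + lambda) * eps c delta t.
Proof.
  set (K := lambda * (delta * delta) + delta * (delta + 1)).
  assert (0 < K) by (unfold K; nra).
  exists (1 + 2 * K). split; [lra|]. intros t ht.
  rewrite zeta2_closed by lra. assert (he := eps_pos t).
  assert (a : 0 <= lambda * (delta * delta) / t + delta * (delta + 1) / (t * t)).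
  { apply Rplus_le_le_0_compat; apply Rdiv_le_0_compat; nra. }
  assert (b : lambda * (delta * delta) / t + delta * (delta + 1) / (t * t) <= 1 / 2).
  { replace (lambda * (delta * delta) / t + delta * (delta + 1) / (t * t))
      with ((lambda * (delta * delta) + delta * (delta + 1) / t) / t) by (field; lra).
    apply Rle_div_l; [lra|].
    assert (delta * (delta + 1) / t <= delta * (delta + 1)).
    { apply Rle_div_l; [lra|]. nra. }
    unfold K in *; lra. }
  split; nra.
Qed.

Lemma same_order_zeta2 : same_order (zeta2 c delta lambda) (eps c delta).
Proof.
  destruct zeta2_bounds as [T [_ hT]].
  split; [exists (1 + lambda)|exists 2]; (split; [lra|]);
    exists T; intros t ht; destruct (hT t) as [lo hi]; try lra;
    assert (he := eps_pos t); rewrite !Rabs_pos_eq; nra.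
Qed.
End Eps.

(** * Calculus on a half-line *)

(** Only pointwise differentiability is required: the derivatives of a
    trajectory and of its residual need not be continuous separately, so the
    energy cannot be recovered by integrating its derivative. *)
Lemma nonincreasing_of_derive (f : R -> R) (a b : R) :
  (forall t, a <= t -> exists d, is_derive f t d /\ d <= 0) ->
  a <= b -> f b <= f a.
Proof.
  intros hf hab.
  destruct (MVT_gen f a b (Derive f)) as [s [hs e]].
  - intros t. rewrite Rmin_left, Rmax_right by lra. intros ht.
    destruct (hf t) as [d [hd _]]; [lra|]. apply Derive_correct. now exists d.
  - intros t. rewrite Rmin_left, Rmax_right by lra. intros ht.
    destruct (hf t) as [d [hd _]]; [lra|].
    apply derivable_continuous_pt. exists d. now apply is_derive_Reals.
  - rewrite Rmin_left, Rmax_right in hs by lra.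
    destruct (hf s) as [d [hd hd0]]; [lra|].
    rewrite (is_derive_unique _ _ _ hd) in e. nra.
Qed.

(** The integrals start at [t0], where a trajectory is constrained on the right
    only. *)
Definition continuous_from {U : UniformSpace} (t0 : R) (f : R -> U) : Prop :=
  forall t, t0 <= t ->
    filterlim f (within (fun s => t0 <= s) (locally t)) (locally (f t)).

Section ContinuousFrom.
Variable t0 : R.

Lemma continuous_from_of_continuous {U : UniformSpace} (f : R -> U) :
  (forall t, t0 <= t -> continuous f t) -> continuous_from t0 f.
Proof.
  intros hf t ht. eapply filterlim_filter_le_1; [|exact (hf t ht)].
  apply filter_le_within.
Qed.

Lemma continuous_from_comp {U W : UniformSpace} (f : R -> U) (F : U -> W) :
  (forall u, continuous F u) -> continuous_from t0 f ->
  continuous_from t0 (fun s => F (f s)).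
Proof.
  intros hF hf t ht.
  exact (filterlim_comp _ _ _ f F _ _ _ (hf t ht) (hF (f t))).
Qed.

Lemma continuous_from_at {U : UniformSpace} (f : R -> U) t :
  continuous_from t0 f -> t0 < t -> continuous f t.
Proof.
  intros hf ht P hP. destruct (hf t (Rlt_le _ _ ht) P hP) as [d hd].
  assert (p : 0 < Rmin d (t - t0)) by (apply Rmin_pos; [apply cond_pos|lra]).
  exists (mkposreal _ p). intros s hs. apply hd.
  - eapply ball_le; [|exact hs]. apply Rmin_l.
  - assert (q : Rabs (s - t) < t - t0).
    { eapply Rlt_le_trans; [exact hs|]. apply Rmin_r. }
    apply Rabs_def2 in q. lra.
Qed.

(** Precomposition with [Rmax t0] turns one-sided continuity at [t0] into
    ordinary continuity without changing the integrand on the interval. *)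
Lemma ex_RInt_from {V : CompleteNormedModule R_AbsRing} (f : R -> V) a b :
  continuous_from t0 f -> t0 <= a <= b -> ex_RInt f a b.
Proof.
  intros hf hab. apply (ex_RInt_ext (fun s => f (Rmax t0 s))).
  { intros s. rewrite Rmin_left, Rmax_right by lra. intros hs.
    now rewrite Rmax_right by lra. }
  apply (ex_RInt_continuous (V := V)). intros s _.
  assert (m : filterlim (Rmax t0) (locally s)
    (within (fun r => t0 <= r) (locally (Rmax t0 s)))).
  { intros P [d hd]. exists d. intros r hr. apply hd; [|apply Rmax_l].
    eapply Rle_lt_trans; [|exact hr].
    change (Rabs (Rmax t0 r - Rmax t0 s) <= Rabs (r - s)).
    unfold Rmax, Rabs.
    destruct (Rle_dec t0 r), (Rle_dec t0 s);
    repeat match goal with |- context [Rcase_abs ?z] => destruct (Rcase_abs z) end; lra. }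
  exact (filterlim_comp _ _ _ _ f _ _ _ m (hf _ (Rmax_l t0 s))).
Qed.

Lemma RInt_Chasles_from {V : CompleteNormedModule R_AbsRing} (f : R -> V) a b d :
  continuous_from t0 f -> t0 <= a <= b -> b <= d ->
  plus (RInt f a b) (RInt f b d) = RInt f a d.
Proof.
  intros hf hab hbd. apply (RInt_Chasles (V := V)); apply ex_RInt_from; auto; lra.
Qed.

Lemma is_derive_RInt_from {V : CompleteNormedModule R_AbsRing} (f : R -> V) a t :
  continuous_from t0 f -> t0 < a <= t ->
  is_derive (fun s => RInt f a s) t (f t).
Proof.
  intros hf hat. apply (is_derive_RInt f _ a).
  - assert (p : 0 < t - t0) by lra. exists (mkposreal _ p). intros s hs.
    apply Rabs_def2 in hs. unfold minus, plus, opp in hs. simpl in hs.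
    apply (RInt_correct (V := V)).
    apply (ex_RInt_continuous (V := V)). intros r hr.
    apply continuous_from_at; [exact hf|].
    revert hr. unfold Rmin, Rmax. destruct (Rle_dec a s); lra.
  - apply continuous_from_at; [exact hf|lra].
Qed.
End ContinuousFrom.

(** * Energy of a trajectory *)

Section Trajectory.
Variables (H : RealHilbert) (h : H -> R) (gradh V : H -> H).
Hypothesis h_convex : convex_fun h.
Hypothesis h_diff : forall z : H, is_gradient h z (gradh z).
Hypothesis h_bounded_below : bounded_below h.
Hypothesis V_cont : forall z : H, continuous V z.
Hypothesis V_monotone : monotone_op V.
Variables c delta t0 : R.
Hypothesis c_pos : 0 < c.
Hypothesis delta_pos : 0 < delta.
Hypothesis t0_pos : 0 < t0.
Variable x : R -> H.
Hypothesis x_sol : solution_trajectory V gradh c delta t0 x.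
Variable xs : H.
Hypothesis xs_zero : V xs = zero.
Variable lambda : R.
Hypothesis lambda_pos : 0 < lambda.
Hypothesis lambda_delta : lambda * delta < 1.

Definition residual (t : R) : H := Phi V gradh c delta t (x t).
(** The differential equation reads [(x + residual)' = - residual], which makes
    [x + residual] the natural point to compare with [xs]. *)
Definition shifted (t : R) : H := minus (plus (x t) (residual t)) xs.
Definition value_gap (t : R) : R := h (x t) - h xs.
Definition pairing (t : R) : R := inner (minus (x t) xs) (V (x t)).
(** Besides the squared distance to [xs], the energy contains half the square of
    the residual plus [eps' * value_gap] ([- delta / t * eps] being [eps']): the
    rate of change of the former is at most [- eps' * value_gap'], and adding the
    latter turns this bound into [eps'' * value_gap]. The factors [1 + lambda]
    and [1 + lambda * t] are those for which the total coefficient of the value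
    gap in the derivative is exactly [- zeta2]. *)
Definition energy (t : R) : R :=
  (1 + lambda) / 2 * inner (shifted t) (shifted t)
  + (1 + lambda * t) *
    (inner (residual t) (residual t) / 2 - delta / t * eps c delta t * value_gap t).

Lemma pairing_ge0 t : 0 <= pairing t.
Proof.
  assert (m := V_monotone (x t) xs). rewrite xs_zero in m.
  rewrite inner_minus_l, inner_zero_l, inner_sym in m. unfold pairing. lra.
Qed.

Lemma gradh_monotone u v : 0 <= inner (minus (gradh u) (gradh v)) (minus u v).
Proof.
  assert (a := convex_gradient_ineq h u (gradh u) v h_convex (h_diff u)).
  assert (b := convex_gradient_ineq h v (gradh v) u h_convex (h_diff v)).
  rewrite inner_minus_r in a, b. rewrite !inner_minus_l, !inner_minus_r. lra.
Qed.

Lemma derivative_from_at (f : R -> H) t l :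
  is_derive_from t0 f t l -> t0 < t -> is_derive f t l.
Proof.
  intros [hl hf] ht. split; [exact hl|]. intros s hs.
  assert (es : t = s).
  { exact (is_filter_lim_locally_unique (K := R_AbsRing) (V := R_NormedModule) t s hs). }
  subst s. intros e.
  destruct (hf t (fun P hP => filter_le_within _ P hP) e) as [d hd].
  assert (p : 0 < Rmin d (t - t0)) by (apply Rmin_pos; [apply cond_pos|lra]).
  exists (mkposreal _ p). intros s hss. apply hd.
  - eapply ball_le; [|exact hss]. apply Rmin_l.
  - assert (q : Rabs (s - t) < t - t0).
    { eapply Rlt_le_trans; [exact hss|]. apply Rmin_r. }
    apply Rabs_def2 in q. lra.
Qed.

Lemma derivative_from_continuous (f : R -> H) :
  (forall t, t0 <= t -> exists l, is_derive_from t0 f t l) -> continuous_from t0 f.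
Proof.
  intros hf t ht. destruct (hf t ht) as [l hl].
  apply (filterdiff_continuous_aux (K := R_AbsRing) (U := R_NormedModule) (V := H)).
  - eexists; exact hl.
  - intros P hP. now apply filter_le_within.
Qed.

Lemma x_continuous_from : continuous_from t0 x.
Proof.
  apply derivative_from_continuous. intros t ht.
  destruct (x_sol t ht) as [dx [_ [hx _]]]. now exists dx.
Qed.

Lemma h_continuous z : continuous h z.
Proof.
  apply (filterdiff_continuous (V := R_NormedModule) h). eexists; exact (h_diff z).
Qed.

Lemma value_gap_continuous_from : continuous_from t0 value_gap.
Proof.
  unfold value_gap. apply (continuous_from_comp t0 x (fun z => h z - h xs)).
  - intros z. apply (continuous_minus (V := R_NormedModule));
      [apply h_continuous|apply continuous_const].
  - exact x_continuous_from.
Qed.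

Lemma pairing_continuous_from : continuous_from t0 pairing.
Proof.
  unfold pairing. apply (continuous_from_comp t0 x (fun z => inner (minus z xs) (V z))).
  - intros z. apply continuous_inner; [|apply V_cont].
    apply (continuous_minus (V := H)); [apply continuous_id|apply continuous_const].
  - exact x_continuous_from.
Qed.

Lemma zeta2_continuous_from : continuous_from t0 (zeta2 c delta lambda).
Proof.
  apply continuous_from_of_continuous. intros t ht. apply continuous_zeta2. lra.
Qed.

Lemma weighted_gap_continuous_from :
  continuous_from t0 (fun s => zeta2 c delta lambda s * value_gap s).
Proof.
  intros t ht.
  exact (filterlim_comp_2 _ _ Rmult (zeta2_continuous_from t ht)
    (value_gap_continuous_from t ht) (filterlim_mult (K := R_AbsRing) _ _)).
Qed.

Lemma weighted_x_continuous_from :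
  continuous_from t0 (fun s => scal (zeta2 c delta lambda s) (x s)).
Proof.
  intros t ht.
  exact (filterlim_comp_2 _ _ scal (zeta2_continuous_from t ht)
    (x_continuous_from t ht) (filterlim_scal (K := R_AbsRing) (V := H) _ _)).
Qed.

(** Let [w] be the residual. Along the trajectory
    [<w', x'> >= eps' <gradh x, x'> = eps' value_gap'] by monotonicity of
    [Phi t], and [w' = - x' - w], whence [<w, w'> <= - eps' value_gap'].
    Moreover [<x - xs, w>] is at least the pairing plus [eps * value_gap] by the
    gradient inequality. The squares of [w] come with total coefficient
    [- (1 + lambda) + lambda / 2 < 0] and are dropped. *)
Lemma energy_derive t : t0 < t ->
  exists d, is_derive energy t d /\
    d <= - ((1 + lambda) * pairing t + zeta2 c delta lambda t * value_gap t).
Proof.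
  intros ht.
  destruct (x_sol t (Rlt_le _ _ ht)) as [dx [dw [hx [hw ode]]]].
  apply derivative_from_at in hx; [|exact ht].
  apply derivative_from_at in hw; [|exact ht].
  fold (residual t) in ode.
  change (is_derive residual t dw) in hw.
  set (w := residual t) in *.
  assert (od : forall v : H, inner dx v + inner dw v + inner w v = 0).
  { intros v. rewrite <- !inner_plus_l, ode. apply inner_zero_l. }
  (* Comparing [Phi s] at the points [x s] and [x t] with the same parameter [s]
     leaves the increment of [eps] times [gradh (x t)]. *)
  assert (mono : - (delta / t) * eps c delta t * inner (gradh (x t)) dx <= inner dw dx).
  { apply (inner_derivatives_ge residual x (eps c delta) t dw dx (gradh (x t))); auto.
    - apply is_derive_eps; lra.
    - apply filter_forall. intros s. unfold residual, Phi.
      assert (mV := V_monotone (x s) (x t)).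
      assert (mh := gradh_monotone (x s) (x t)).
      assert (he := eps_pos c delta c_pos s).
      rewrite !inner_minus_l, !inner_minus_r in mV, mh.
      rewrite !inner_minus_l, !inner_plus_l, !inner_scal_l, !inner_minus_r.
      nra. }
  assert (hy : is_derive shifted t (plus dx dw)).
  { unfold shifted.
    refine (filterdiff_ext_lin _ _ _ (is_derive_minus (V := H) _ _ _ _ _
      (is_derive_plus (V := H) _ _ _ _ _ hx hw) (is_derive_const xs t)) _).
    intros s. apply inner_ext. intros v.
    change (inner (scal (s : R) (minus (plus dx dw) (zero : H))) v
      = inner (scal (s : R) (plus dx dw)) v).
    rewrite !inner_scal_l, inner_minus_l, inner_zero_l. ring. }
  assert (hy2 := is_derive_comp_gradient _ _ _ _ _ (is_gradient_sqnorm (shifted t)) hy).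
  assert (hw2 := is_derive_comp_gradient _ _ _ _ _ (is_gradient_sqnorm (residual t)) hw).
  assert (hh := is_derive_comp_gradient _ _ _ _ _ (h_diff (x t)) hx).
  assert (he := is_derive_eps c delta t ltac:(lra)).
  assert (he' := is_derive_eps' c delta t ltac:(lra)).
  simpl in hy2, hw2.
  exists ((1 + lambda) / 2 * inner (scal 2 (shifted t)) (plus dx dw)
    + (lambda * (inner w w / 2 - delta / t * eps c delta t * value_gap t)
    + (1 + lambda * t) * (inner (scal 2 w) dw / 2
        + delta * (delta + 1) / (t * t) * eps c delta t * value_gap t
        - delta / t * eps c delta t * inner (gradh (x t)) dx))).
  split.
  - unfold energy, value_gap.
    apply (is_derive_ext (fun s => (1 + lambda) / 2 * inner (shifted s) (shifted s) +
     (1 + lambda * s) * (inner (residual s) (residual s) / 2 +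
        (- (delta / s) * eps c delta s) * (h (x s) - h xs)))).
    { intros s. simpl; ring. }
    set (e1 := fun s => - (delta / s) * eps c delta s) in *.
    set (n1 := fun s => inner (shifted s) (shifted s)) in *.
    set (n2 := fun s => inner (residual s) (residual s)) in *.
    set (hx' := fun s => h (x s)) in *.
    apply (is_derive_ext (fun s => (1 + lambda) / 2 * n1 s +
     (1 + lambda * s) * (n2 s / 2 + e1 s * (hx' s - h xs)))).
    { intros s. reflexivity. }
    auto_derive.
    + repeat split; eexists; eassumption.
    + change (fun s => n1 s) with n1. change (fun s => n2 s) with n2.
      change (fun s => e1 s) with e1. change (fun s => hx' s) with hx'.
      replace (Derive n1 t) with (inner (scal 2 (shifted t)) (plus dx dw))
        by (symmetry; exact (is_derive_unique _ _ _ hy2)).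
      replace (Derive n2 t) with (inner (scal 2 w) dw)
        by (symmetry; exact (is_derive_unique _ _ _ hw2)).
      replace (Derive hx' t) with (inner (gradh (x t)) dx)
        by (symmetry; exact (is_derive_unique _ _ _ hh)).
      replace (Derive e1 t) with (delta * (delta + 1) / (t * t) * eps c delta t)
        by (symmetry; exact (is_derive_unique _ _ _ he')).
      unfold n2, hx', e1. fold w. field. lra.
  - rewrite zeta2_closed by lra.
    assert (es := eps_pos c delta c_pos t).
    assert (lt : 0 < 1 + lambda * t) by nra.
    assert (s1 : inner (shifted t) (plus dx dw)
      <= - (pairing t + eps c delta t * value_gap t + inner w w)).
    { assert (ci := convex_gradient_ineq h (x t) (gradh (x t)) xs h_convex (h_diff (x t))).
      assert (e : inner (shifted t) (plus dx dw) = - inner (shifted t) w).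
      { rewrite inner_plus_r, !(inner_sym (shifted t)). generalize (od (shifted t)). lra. }
      rewrite e. unfold shifted. fold w.
      assert (e2 : inner (minus (x t) xs) w
        = pairing t + eps c delta t * inner (gradh (x t)) (minus (x t) xs)).
      { unfold w, residual, Phi, pairing.
        rewrite inner_plus_r, inner_scal_r, (inner_sym _ (gradh (x t))). reflexivity. }
      rewrite inner_minus_l, inner_plus_l. rewrite inner_minus_l in e2.
      unfold value_gap. rewrite inner_minus_r in ci, e2. nra. }
    assert (s2 : inner w dw <= delta / t * eps c delta t * inner (gradh (x t)) dx).
    { assert (o := od dw). assert (p := inner_pos dw). rewrite (inner_sym dx dw) in o. lra. }
    rewrite !inner_scal_l.
    assert (pw := inner_pos w).
    set (a := inner (shifted t) (plus dx dw)) in *.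
    set (b := inner w dw) in *. set (g' := inner (gradh (x t)) dx) in *.
    set (W := inner w w) in *. set (g := value_gap t) in *. set (P := pairing t) in *.
    set (ep := eps c delta t) in *.
    apply Rle_trans with
      (- (1 + lambda) * (P + ep * g + W) + (lambda * (W / 2 - delta / t * ep * g)
        + (1 + lambda * t) * (delta * (delta + 1) / (t * t) * ep * g))).
    + assert ((1 + lambda) * a <= (1 + lambda) * - (P + ep * g + W))
        by (apply Rmult_le_compat_l; lra).
      assert ((1 + lambda * t) * b <= (1 + lambda * t) * (delta / t * ep * g'))
        by (apply Rmult_le_compat_l; lra).
      lra.
    + match goal with |- ?l <= ?r => replace l with (r - (1 + lambda / 2) * W) by (field; lra) end.
      nra.
Qed.

(** The only term of the energy without a sign is the one carrying the value
    gap. The gradient inequality gives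
    [eps * value_gap <= <x - xs, w> = <y, w> - |w|^2 <= |y|^2 / 4] for the
    residual [w] and the shifted point [y], and the coefficient
    [lambda * delta + delta / t] is at most one for large [t] because
    [lambda < 1 / delta]. *)
Lemma energy_lower t :
  t0 <= t -> lambda * delta + delta / t <= 1 ->
  lambda * t / 2 * (norm (residual t) * norm (residual t)) <= energy t.
Proof.
  intros ht hl. unfold energy. rewrite norm_sqr.
  assert (es := eps_pos c delta c_pos t).
  assert (k : eps c delta t * value_gap t <= inner (shifted t) (shifted t) / 4).
  { assert (ci := convex_gradient_ineq h (x t) (gradh (x t)) xs h_convex (h_diff (x t))).
    assert (pp := pairing_ge0 t).
    assert (sq := inner_pos (minus (shifted t) (scal 2 (residual t)))).
    assert (e2 : inner (minus (x t) xs) (residual t)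
      = pairing t + eps c delta t * inner (gradh (x t)) (minus (x t) xs)).
    { unfold residual, Phi, pairing.
      rewrite inner_plus_r, inner_scal_r, (inner_sym _ (gradh (x t))). reflexivity. }
    assert (e3 : inner (shifted t) (residual t)
      = inner (minus (x t) xs) (residual t) + inner (residual t) (residual t)).
    { unfold shifted. rewrite !inner_minus_l, inner_plus_l. ring. }
    rewrite inner_minus_l, !inner_minus_r, !inner_scal_l, !inner_scal_r,
      (inner_sym (residual t) (shifted t)) in sq.
    rewrite inner_minus_r in ci, e2. unfold value_gap.
    assert (ci' : eps c delta t * (h (x t) - h xs)
      <= eps c delta t * (inner (gradh (x t)) (x t) - inner (gradh (x t)) xs)).
    { apply Rmult_le_compat_l; lra. }
    lra. }
  assert (ps := inner_pos (shifted t)). assert (pw := inner_pos (residual t)).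
  set (S := inner (shifted t) (shifted t)) in *.
  set (W := inner (residual t) (residual t)) in *.
  set (g := eps c delta t * value_gap t) in *.
  replace ((1 + lambda) / 2 * S + (1 + lambda * t) * (W / 2 - delta / t * eps c delta t * value_gap t))
    with ((1 + lambda) / 2 * S + (1 + lambda * t) * (W / 2) - (lambda * delta + delta / t) * g)
    by (unfold g; field; lra).
  assert (0 <= delta / t) by (apply Rdiv_le_0_compat; lra).
  assert (0 <= lambda * delta) by (apply Rmult_le_pos; lra).
  set (q := lambda * delta + delta / t) in *.
  assert (0 <= q) by (unfold q; lra).
  assert (q * g <= S / 4) by (destruct (Rle_lt_dec 0 g); nra).
  nra.
Qed.

Lemma is_derive_weight_integral T t : t0 < T -> T <= t ->
  is_derive (fun s => RInt (zeta2 c delta lambda) T s) t (zeta2 c delta lambda t).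
Proof.
  intros hT ht. apply (is_derive_RInt_from t0); [apply zeta2_continuous_from|lra].
Qed.

Lemma is_derive_weighted_gap_integral T t : t0 < T -> T <= t ->
  is_derive (fun s => RInt (fun r => zeta2 c delta lambda r * value_gap r) T s) t
    (zeta2 c delta lambda t * value_gap t).
Proof.
  intros hT ht.
  apply (is_derive_RInt_from t0 (fun r => zeta2 c delta lambda r * value_gap r));
    [apply weighted_gap_continuous_from|lra].
Qed.

(** The dissipation inequality in integrated form. The sign of the value gap is
    unknown, so the two integrals are kept together. *)
Lemma energy_balance T t :
  t0 < T -> T <= t ->
  energy t + (1 + lambda) * RInt pairing T t
    + RInt (fun s => zeta2 c delta lambda s * value_gap s) T t <= energy T.
Proof.
  intros hT ht.
  set (I1 := fun s => RInt pairing T s).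
  set (I2 := fun s => RInt (fun r => zeta2 c delta lambda r * value_gap r) T s).
  assert (m := nonincreasing_of_derive (fun s => energy s + (1 + lambda) * I1 s + I2 s) T t).
  simpl in m. change (energy t + (1 + lambda) * I1 t + I2 t <= energy T).
  replace (energy T) with (energy T + (1 + lambda) * I1 T + I2 T).
  - apply m; [|exact ht]. intros s hs.
    destruct (energy_derive s ltac:(lra)) as [d [hd dle]].
    assert (d1 : is_derive I1 s (pairing s)).
    { apply (is_derive_RInt_from t0); [apply pairing_continuous_from|lra]. }
    assert (d2 : is_derive I2 s (zeta2 c delta lambda s * value_gap s)).
    { apply is_derive_weighted_gap_integral; assumption. }
    exists (d + (1 + lambda) * pairing s + zeta2 c delta lambda s * value_gap s). split.
    + apply (is_derive_plus (V := R_NormedModule)); [|exact d2].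
      apply (is_derive_plus (V := R_NormedModule)); [exact hd|].
      apply is_derive_scal. exact d1.
    + lra.
  - unfold I1, I2.
    assert (z1 : RInt pairing T T = 0) by exact (RInt_point T pairing).
    assert (z2 : RInt (fun r => zeta2 c delta lambda r * value_gap r) T T = 0)
      by exact (RInt_point T (fun r => zeta2 c delta lambda r * value_gap r)).
    rewrite z1, z2. ring.
Qed.

Lemma threshold :
  exists T, t0 < T /\ forall t, T <= t ->
    lambda * delta + delta / t <= 1 /\
    (1 + lambda) / 2 * eps c delta t <= zeta2 c delta lambda t
      <= (1 + lambda) * eps c delta t.
Proof.
  destruct (zeta2_bounds c delta lambda c_pos delta_pos lambda_pos) as [T1 [T1pos hT1]].
  assert (p : 0 < delta / (1 - lambda * delta)) by (apply Rdiv_lt_0_compat; lra).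
  exists (t0 + T1 + delta / (1 - lambda * delta)). split; [lra|].
  intros t ht. split; [|apply hT1; lra].
  assert (delta / t <= 1 - lambda * delta).
  { apply Rle_div_l; [lra|]. rewrite Rmult_comm. apply Rle_div_l; lra. }
  lra.
Qed.

Section Primitive.
Variable Theta : R -> R.
Hypothesis Theta_derive : forall t, 0 < t -> is_derive Theta t (eps c delta t).

(** Since [h] is bounded below, the value gap is at least [- G], and its weighted
    integral costs at most a multiple of the integral of [eps]. *)
Lemma dissipation_bound :
  exists T C K, t0 < T /\ 0 <= C /\ 0 <= K /\ forall t, T <= t ->
    t * (norm (residual t) * norm (residual t)) <= C + K * Theta t /\
    0 <= RInt pairing t0 t <= C + K * Theta t.
Proof.
  destruct threshold as [T [hT hb]].
  destruct h_bounded_below as [m hm].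
  set (G := Rmax 0 (h xs - m)).
  assert (G0 : 0 <= G) by apply Rmax_l.
  assert (Gm : forall t, - G <= value_gap t).
  { intros t. unfold value_gap. generalize (hm (x t)) (Rmax_r 0 (h xs - m)). fold G. lra. }
  set (K := (1 + lambda) * G).
  assert (K0 : 0 <= K) by (unfold K; nra).
  assert (P0 : forall a b, t0 <= a <= b -> 0 <= RInt pairing a b).
  { intros a b hab. apply RInt_ge_0; [lra| |intros; apply pairing_ge0].
    apply (ex_RInt_from t0 (V := R_CompleteNormedModule)); [apply pairing_continuous_from|lra]. }
  assert (low : forall t, T <= t -> - (K * (Theta t - Theta T))
    <= RInt (fun r => zeta2 c delta lambda r * value_gap r) T t).
  { intros t ht.
    set (I2 := fun s => RInt (fun r => zeta2 c delta lambda r * value_gap r) T s).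
    assert (m1 := nonincreasing_of_derive (fun s => - (K * Theta s) - I2 s) T t).
    assert (z2 : I2 T = 0)
      by exact (RInt_point T (fun r => zeta2 c delta lambda r * value_gap r)).
    assert (m2 : - (K * Theta t) - I2 t <= - (K * Theta T) - I2 T).
    { apply m1; [|exact ht]. intros s hs.
      assert (d2 := is_derive_weighted_gap_integral T s hT hs).
      exists (- (K * eps c delta s) - zeta2 c delta lambda s * value_gap s). split.
      - apply (is_derive_minus (V := R_NormedModule)); [|exact d2].
        apply (is_derive_opp (V := R_NormedModule)).
        apply is_derive_scal. apply Theta_derive. lra.
      - destruct (hb s hs) as [_ [z0 z1]].
        assert (es := eps_pos c delta c_pos s).
        assert (zp : 0 <= zeta2 c delta lambda s) by nra.
        assert (gs := Gm s).
        assert (zeta2 c delta lambda s * - G <= zeta2 c delta lambda s * value_gap s)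
          by (apply Rmult_le_compat_l; lra).
        assert (zeta2 c delta lambda s * G <= (1 + lambda) * eps c delta s * G)
          by (apply Rmult_le_compat_r; lra).
        unfold K. lra. }
    rewrite z2 in m2. change (- (K * (Theta t - Theta T)) <= I2 t). lra. }
  set (E0 := energy T - K * Theta T).
  assert (bal : forall t, T <= t ->
    lambda * t / 2 * (norm (residual t) * norm (residual t)) <= E0 + K * Theta t /\
    RInt pairing T t <= E0 + K * Theta t).
  { intros t ht. assert (b := energy_balance T t hT ht). assert (l := low t ht).
    assert (el := energy_lower t ltac:(lra) (proj1 (hb t ht))).
    assert (p := P0 T t ltac:(lra)).
    assert (0 <= lambda * t / 2 * (norm (residual t) * norm (residual t))).
    { rewrite norm_sqr. apply Rmult_le_pos; [nra|apply inner_pos]. }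
    unfold E0. split; nra. }
  set (k := 1 + 2 / lambda).
  assert (k2 : 0 < 2 / lambda) by (apply Rdiv_lt_0_compat; lra).
  set (C := Rmax 0 (k * E0) + RInt pairing t0 T).
  assert (CP := P0 t0 T ltac:(lra)).
  assert (C1 := Rmax_l 0 (k * E0)). assert (C2 := Rmax_r 0 (k * E0)).
  exists T, C, (k * K). split; [exact hT|]. split; [unfold C; lra|].
  split; [unfold k; nra|]. intros t ht.
  destruct (bal t ht) as [b1 b2].
  assert (p := P0 T t ltac:(lra)).
  assert (ch : RInt pairing t0 T + RInt pairing T t = RInt pairing t0 t).
  { apply (RInt_Chasles_from t0 (V := R_CompleteNormedModule));
      [apply pairing_continuous_from|lra|lra]. }
  set (A := E0 + K * Theta t) in *.
  assert (A0 : 0 <= A) by lra.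
  assert (kA : k * A = k * E0 + k * K * Theta t) by (unfold A; ring).
  assert (kA1 : A <= k * A) by (unfold k; nra).
  assert (kA2 : 2 / lambda * A <= k * A) by (unfold k; nra).
  split; [|unfold C; lra].
  apply Rle_trans with (2 / lambda * A); [|unfold C; lra].
  replace (t * (norm (residual t) * norm (residual t)))
    with (2 / lambda * (lambda * t / 2 * (norm (residual t) * norm (residual t))))
    by (field; lra).
  apply Rmult_le_compat_l; lra.
Qed.

(** Convexity inequality for the weighted mean when the weight may be negative
    before [T]: the part of the integral before [T] enters as one point whose
    total weight is positive. The gradient inequality at the mean itself is
    integrated, and the linear terms cancel. *)
Lemma ergodic_convexity T t :
  t0 < T -> T <= t ->
  0 < zeta2_int c delta lambda t0 T ->
  (forall s, T <= s -> 0 <= zeta2 c delta lambda s) ->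
  0 < zeta2_int c delta lambda t0 t /\
  zeta2_int c delta lambda t0 t * (h (xbar c delta lambda t0 x t) - h xs)
  <= zeta2_int c delta lambda t0 T * (h (xbar c delta lambda t0 x T) - h xs)
     + RInt (fun s => zeta2 c delta lambda s * value_gap s) T t.
Proof.
  intros hT ht Zpos zpos.
  set (z := zeta2 c delta lambda).
  set (zx := fun s => scal (z s) (x s)).
  set (p := xbar c delta lambda t0 x t).
  set (a := xbar c delta lambda t0 x T).
  set (u := gradh p).
  set (Z := zeta2_int c delta lambda t0 t). set (Z0 := zeta2_int c delta lambda t0 T) in *.
  set (Z1 := RInt z T t). set (B := RInt zx T t : H).
  assert (eZ : Z = Z0 + Z1).
  { symmetry. apply (RInt_Chasles_from t0 (V := R_CompleteNormedModule));
      [apply zeta2_continuous_from|lra|lra]. }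
  assert (Z1pos : 0 <= Z1).
  { apply RInt_ge_0; [lra| |intros; apply zpos; lra].
    apply (ex_RInt_from t0 (V := R_CompleteNormedModule)); [apply zeta2_continuous_from|lra]. }
  assert (eA : RInt zx t0 T = scal Z0 a).
  { apply inner_ext. intros v. unfold a, xbar. fold z. fold zx. fold Z0.
    rewrite !inner_scal_l. field. lra. }
  assert (ep : scal Z p = plus (scal Z0 a) B).
  { rewrite <- eA. unfold B.
    assert (ch : plus (RInt zx t0 T) (RInt zx T t) = RInt zx t0 t).
    { apply (RInt_Chasles_from t0 (V := H)); [apply weighted_x_continuous_from|lra|lra]. }
    apply inner_ext. intros v.
    transitivity (inner (RInt zx t0 t : H) v); [|rewrite <- ch; reflexivity].
    unfold p, xbar. fold z. fold zx. fold Z.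
    rewrite !inner_scal_l. field. lra. }
  split; [lra|].
  set (q := h p - h xs - inner u p).
  assert (key : q * Z1 + inner u B <= RInt (fun s => z s * value_gap s) T t).
  { set (I0 := fun s => RInt z T s). set (IB := fun s => RInt zx T s : H).
    set (I2 := fun s => RInt (fun r => z r * value_gap r) T s).
    assert (m1 := nonincreasing_of_derive (fun s => q * I0 s + inner u (IB s) - I2 s) T t).
    assert (z0 : I0 T = 0) by exact (RInt_point T z).
    assert (zB : IB T = zero) by exact (RInt_point T zx).
    assert (z2 : I2 T = 0) by exact (RInt_point T (fun r => z r * value_gap r)).
    assert (m2 : q * I0 t + inner u (IB t) - I2 t <= q * I0 T + inner u (IB T) - I2 T).
    { apply m1; [|exact ht]. intros s hs.
      assert (d0 := is_derive_weight_integral T s hT hs).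
      assert (d2 := is_derive_weighted_gap_integral T s hT hs).
      assert (dB : is_derive IB s (zx s)).
      { apply (is_derive_RInt_from t0 (V := H)); [apply weighted_x_continuous_from|lra]. }
      assert (gB : is_gradient (fun v : H => inner u v) (IB s) u).
      { apply (filterdiff_linear (K := R_AbsRing) (U := H) (V := R_NormedModule)).
        apply is_linear_inner. }
      exists (q * z s + inner u (zx s) - z s * value_gap s). split.
      - apply (is_derive_minus (V := R_NormedModule)); [|exact d2].
        apply (is_derive_plus (V := R_NormedModule)).
        + apply is_derive_scal. exact d0.
        + exact (is_derive_comp_gradient _ IB s _ _ gB dB).
      - assert (ci := convex_gradient_ineq h p u (x s) h_convex (h_diff p)).
        rewrite inner_minus_r in ci. unfold zx. rewrite inner_scal_r.
        assert (zp : 0 <= z s) by (apply zpos; lra).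
        assert (z s * (h p + (inner u (x s) - inner u p)) <= z s * h (x s))
          by (apply Rmult_le_compat_l; lra).
        unfold q, value_gap. lra. }
    rewrite z0, zB, z2, inner_zero_r in m2.
    change (q * I0 t + inner u (IB t) <= I2 t). lra. }
  assert (ca := convex_gradient_ineq h p u a h_convex (h_diff p)).
  assert (epu : Z * inner u p = Z0 * inner u a + inner u B).
  { rewrite <- !inner_scal_r, <- inner_plus_r. f_equal. exact ep. }
  rewrite inner_minus_r in ca.
  assert (Z0 * (h p + (inner u a - inner u p)) <= Z0 * h a)
    by (apply Rmult_le_compat_l; lra).
  unfold q in key. rewrite eZ in *. nra.
Qed.

(** The weighted integral of the value gap is bounded by the energy, which is
    eventually nonnegative, while the total weight is eventually at least a
    quarter of [Theta]. *)
Lemma value_bound (xbest : R -> H) :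
  (forall M, exists T, forall t, T <= t -> M <= Theta t) ->
  (forall t : R, t0 <= t -> zeta2_int c delta lambda t0 t <> 0 ->
    is_argmin (fun z : H => z = x t \/ z = xbar c delta lambda t0 x t)
      h (xbest t)) ->
  exists T C, t0 < T /\ 0 <= C /\ forall t, T <= t ->
    0 < Theta t /\ h (xbest t) - h xs <= C / Theta t.
Proof.
  intros Theta_infty best.
  destruct threshold as [T [hT hb]].
  set (Z := zeta2_int c delta lambda t0).
  assert (Zlow : forall t, T <= t -> Z T + (Theta t - Theta T) / 2 <= Z t).
  { intros t ht.
    set (I0 := fun s => RInt (zeta2 c delta lambda) T s).
    assert (m1 := nonincreasing_of_derive (fun s => / 2 * Theta s - I0 s) T t).
    assert (z0 : I0 T = 0) by exact (RInt_point T (zeta2 c delta lambda)).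
    assert (m2 : / 2 * Theta t - I0 t <= / 2 * Theta T - I0 T).
    { apply m1; [|exact ht]. intros s hs.
      assert (d0 := is_derive_weight_integral T s hT hs).
      exists (/ 2 * eps c delta s - zeta2 c delta lambda s). split.
      - apply (is_derive_minus (V := R_NormedModule)); [|exact d0].
        apply is_derive_scal. apply Theta_derive. lra.
      - destruct (hb s hs) as [_ [l _]]. assert (es := eps_pos c delta c_pos s). nra. }
    assert (ch : Z T + I0 t = Z t).
    { apply (RInt_Chasles_from t0 (V := R_CompleteNormedModule));
      [apply zeta2_continuous_from|lra|lra]. }
    lra. }
  (* By [Zlow] this value of [Theta] makes the total weight at least [1 / 2]. *)
  destruct (Theta_infty (1 + Theta T - 2 * Z T)) as [T1 hT1].
  set (T2 := Rmax T T1).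
  assert (TT2 : T <= T2) by apply Rmax_l.
  assert (T1T2 : T1 <= T2) by apply Rmax_r.
  assert (Zpos : 0 < Z T2).
  { generalize (Zlow T2 TT2) (hT1 T2 T1T2). lra. }
  set (C := Rmax 0 (Z T2 * (h (xbar c delta lambda t0 x T2) - h xs) + energy T2)).
  (* By [Zlow] this value of [Theta] gives [Theta / 4 <= Z]. *)
  destruct (Theta_infty (Rmax 1 (2 * Theta T - 4 * Z T))) as [T3 hT3].
  set (T4 := Rmax T2 T3).
  assert (T2T4 : T2 <= T4) by apply Rmax_l.
  assert (T3T4 : T3 <= T4) by apply Rmax_r.
  assert (C0 : 0 <= C) by apply Rmax_l.
  exists T4, (4 * C). split; [lra|]. split; [lra|]. intros t ht.
  assert (th := hT3 t ltac:(lra)).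
  assert (th1 := Rmax_l 1 (2 * Theta T - 4 * Z T)).
  assert (th2 := Rmax_r 1 (2 * Theta T - 4 * Z T)).
  assert (Zt := Zlow t ltac:(lra)).
  assert (ZTheta : Theta t / 4 <= Z t) by lra.
  split; [lra|].
  destruct (ergodic_convexity T2 t ltac:(lra) ltac:(lra) Zpos) as [Ztpos erg].
  { intros s hs. destruct (hb s ltac:(lra)) as [_ [l _]].
    assert (es := eps_pos c delta c_pos s). nra. }
  assert (bal := energy_balance T2 t ltac:(lra) ltac:(lra)).
  assert (el : 0 <= energy t).
  { eapply Rle_trans; [|apply energy_lower; [lra|apply hb; lra]].
    rewrite norm_sqr. apply Rmult_le_pos; [nra|apply inner_pos]. }
  assert (pp : 0 <= RInt pairing T2 t).
  { apply RInt_ge_0; [lra| |intros; apply pairing_ge0].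
    apply (ex_RInt_from t0 (V := R_CompleteNormedModule)); [apply pairing_continuous_from|lra]. }
  assert (up : Z t * (h (xbar c delta lambda t0 x t) - h xs) <= C).
  { eapply Rle_trans; [exact erg|]. eapply Rle_trans; [|apply Rmax_r].
    change (zeta2_int c delta lambda t0 T2) with (Z T2). nra. }
  destruct (best t ltac:(lra) ltac:(lra)) as [_ bm].
  assert (b := bm _ (or_intror eq_refl)).
  apply Rle_trans with (h (xbar c delta lambda t0 x t) - h xs); [lra|].
  apply Rle_trans with (C / Z t).
  - apply Rle_div_r; [exact Ztpos|]. fold (Z t). lra.
  - apply Rle_div_l; [exact Ztpos|].
    replace (4 * C / Theta t * Z t) with (C * (4 * Z t / Theta t)) by (field; lra).
    rewrite <- (Rmult_1_r C) at 1. apply Rmult_le_compat_l; [exact C0|].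
    apply Rle_div_r; lra.
Qed.
End Primitive.
End Trajectory.

(** * Growth of the primitive and rates *)

Lemma Rpower_one_minus t delta :
  0 < t -> Rpower t (1 - delta) = t / Rpower t delta.
Proof.
  intros ht. unfold Rminus. rewrite Rpower_plus, Rpower_1, Rpower_Ropp by exact ht.
  reflexivity.
Qed.

Lemma is_derive_power_primitive c delta t :
  delta <> 1 -> 0 < t ->
  is_derive (fun s => c / (1 - delta) * Rpower s (1 - delta)) t (eps c delta t).
Proof.
  intros hd ht. unfold eps.
  replace (c / Rpower t delta) with (c * Rpower t (1 - delta) / t).
  - unfold Rpower. auto_derive; [easy|]. field.
    split; [lra|]. intros e. apply hd. lra.
  - rewrite Rpower_one_minus by exact ht. field.
    split; [apply Rgt_not_eq, exp_pos|lra].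
Qed.

Lemma is_derive_log_primitive c t :
  0 < t -> is_derive (fun s => c * ln s) t (eps c 1 t).
Proof.
  intros ht. unfold eps. rewrite Rpower_1 by exact ht. auto_derive; [easy|]. field. lra.
Qed.

Lemma log_primitive_infty c M :
  0 < c -> exists T, forall t, T <= t -> M <= c * ln t.
Proof.
  intros hc. exists (exp (M / c)). intros t ht.
  assert (l : M / c <= ln t).
  { rewrite <- (ln_exp (M / c)). apply ln_le; [apply exp_pos|exact ht]. }
  apply Rle_div_l in l; lra.
Qed.

(** From [exp y >= y], the primitive dominates [c * ln t]. *)
Lemma power_primitive_infty c delta M :
  0 < c -> delta < 1 ->
  exists T, forall t, T <= t -> M <= c / (1 - delta) * Rpower t (1 - delta).
Proof.
  intros hc hd. destruct (log_primitive_infty c M hc) as [T hT].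
  exists T. intros t ht. apply Rle_trans with (1 := hT t ht).
  replace (c * ln t) with (c / (1 - delta) * ((1 - delta) * ln t)) by (field; lra).
  apply Rmult_le_compat_l.
  - apply Rdiv_le_0_compat; lra.
  - unfold Rpower. generalize (exp_ineq1_le ((1 - delta) * ln t)). lra.
Qed.

Lemma power_primitive_nonpos c delta t :
  0 < c -> 1 < delta -> c / (1 - delta) * Rpower t (1 - delta) <= 0 * 1.
Proof.
  intros hc hd.
  replace (c / (1 - delta) * Rpower t (1 - delta))
    with (- (c / (delta - 1) * Rpower t (1 - delta))) by (field; lra).
  assert (0 <= c / (delta - 1) * Rpower t (1 - delta)); [|lra].
  apply Rmult_le_pos; [apply Rdiv_le_0_compat; lra|left; apply exp_pos].
Qed.

Lemma ln_ge_1 t : exp 1 <= t -> 1 <= ln t.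
Proof.
  intros ht. rewrite <- (ln_exp 1). apply ln_le; [apply exp_pos|exact ht].
Qed.

Lemma Rpower_ge_1 t a : 1 <= t -> 0 <= a -> 1 <= Rpower t a.
Proof.
  intros ht ha. rewrite <- (Rpower_O t) by lra. apply Rle_Rpower; lra.
Qed.

Lemma bigO_ext (f g g' : R -> R) :
  (forall t, 0 < t -> g t = g' t) -> bigO f g -> bigO f g'.
Proof.
  intros e [C [hC [T hT]]]. exists C. split; [exact hC|].
  exists (Rmax 0 T). intros t ht.
  assert (a := Rmax_l 0 T). assert (b := Rmax_r 0 T).
  rewrite <- e by lra. apply hT. lra.
Qed.

(** [rho] is the growth of the primitive [Theta]: [1], [ln t] or
    [t^(1 - delta)]. Being at least one, it also absorbs the constant. *)
Lemma bigO_rates (n I Theta rho : R -> R) (T C K T' L : R) :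
  0 <= C -> 0 <= K -> 0 <= L ->
  (forall t, 0 <= n t) ->
  (forall t, T <= t -> t * (n t * n t) <= C + K * Theta t
                       /\ 0 <= I t <= C + K * Theta t) ->
  (forall t, T' <= t -> 1 <= rho t /\ Theta t <= L * rho t) ->
  bigO n (fun t => sqrt (rho t / t)) /\
  bigO (fun t => 1 / t * I t) (fun t => rho t / t).
Proof.
  intros hC hK hL hn hI hrho. set (D := C + K * L).
  assert (hD : 0 <= D) by (unfold D; nra).
  assert (dom : forall t, T <= t -> T' <= t -> C + K * Theta t <= D * rho t).
  { intros t h1 h2. destruct (hrho t h2) as [r1 r2].
    assert (K * Theta t <= K * (L * rho t)) by (apply Rmult_le_compat_l; lra).
    unfold D. nra. }
  set (B := Rmax 1 (Rmax T T')).
  assert (b1 : 1 <= B) by apply Rmax_l.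
  assert (b2 : T <= B) by (eapply Rle_trans; [apply Rmax_l|apply Rmax_r]).
  assert (b3 : T' <= B) by (eapply Rle_trans; [apply Rmax_r|apply Rmax_r]).
  split; [exists (sqrt D)|exists D]; (split; [solve [apply sqrt_pos|exact hD]|]);
    exists B; intros t ht;
    destruct (hI t ltac:(lra)) as [i1 i2]; destruct (hrho t ltac:(lra)) as [r _];
    assert (d := dom t ltac:(lra) ltac:(lra));
    assert (q : 0 <= rho t / t) by (apply Rdiv_le_0_compat; lra).
  - rewrite (Rabs_pos_eq (n t)), (Rabs_pos_eq (sqrt _)) by (apply sqrt_pos || apply hn).
    rewrite <- sqrt_mult by (exact hD || exact q).
    rewrite <- (sqrt_square (n t)) by apply hn. apply sqrt_le_1_alt.
    replace (D * (rho t / t)) with (D * rho t / t) by (field; lra).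
    apply (proj1 (Rle_div_r _ (D * rho t) t ltac:(lra))). lra.
  - rewrite !Rabs_pos_eq; [|exact q|].
    + replace (1 / t * I t) with (I t / t) by (field; lra).
      replace (D * (rho t / t)) with (D * rho t / t) by (field; lra).
      apply Rmult_le_compat_r; [|lra]. left; apply Rinv_0_lt_compat; lra.
    + apply Rmult_le_pos; [apply Rdiv_le_0_compat; lra|lra].
Qed.

Lemma power_rate t delta : 0 < t -> Rpower t (1 - delta) / t = 1 / Rpower t delta.
Proof.
  intros ht. rewrite Rpower_one_minus by exact ht.
  field. split; [apply Rgt_not_eq, exp_pos|lra].
Qed.

Lemma sqrt_power_rate t delta :
  0 < t -> sqrt (Rpower t (1 - delta) / t) = 1 / Rpower t (delta / 2).
Proof.
  intros ht. rewrite power_rate by exact ht.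
  assert (p : 0 < Rpower t (delta / 2)) by apply exp_pos.
  rewrite <- (sqrt_square (1 / Rpower t (delta / 2))).
  - f_equal. replace delta with (delta / 2 + delta / 2) at 1 by field.
    rewrite Rpower_plus. field. lra.
  - apply Rdiv_le_0_compat; lra.
Qed.

Theorem theorem2p2
  (H : RealHilbert) (h : H -> R) (gradh V : H -> H)
  (h_convex : convex_fun h)
  (h_diff : forall z : H, is_gradient h z (gradh z))
  (gradh_cont : forall z : H, continuous gradh z)
  (h_bounded_below : bounded_below h)
  (gradh_bounded : bounded_on_bounded gradh)
  (V_cont : forall z : H, continuous V z)
  (V_monotone : monotone_op V)
  (c delta t0 : R) (c_pos : 0 < c) (delta_pos : 0 < delta) (t0_pos : 0 < t0)
  (x : R -> H) (x_sol : solution_trajectory V gradh c delta t0 x)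
  (xs : H) (xs_opt : optimal_solution V h xs)
  (lambda : R) (lambda_range : 0 < lambda < 1 / delta)
  (xbest : R -> H)
  (xbest_argmin : forall t : R, t0 <= t -> zeta2_int c delta lambda t0 t <> 0 ->
    is_argmin (fun z : H => z = x t \/ z = xbar c delta lambda t0 x t)
      h (xbest t)) :
  same_order (zeta2 c delta lambda) (eps c delta) /\
  (let res := fun t : R => norm (Phi V gradh c delta t (x t)) in
   (1 < delta -> bigO res (fun t => 1 / sqrt t)) /\
   (delta = 1 -> bigO res (fun t => sqrt (ln t / t))) /\
   (delta < 1 -> bigO res (fun t => 1 / Rpower t (delta / 2)))) /\
  (let gap := fun t : R =>
     1 / t * RInt (fun s : R => inner (minus (x s) xs) (V (x s))) t0 t in
   (1 < delta -> bigO gap (fun t => 1 / t)) /\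
   (delta = 1 -> bigO gap (fun t => ln t / t)) /\
   (delta < 1 -> bigO gap (fun t => 1 / Rpower t delta))) /\
  (let hgap := fun t : R => h (xbest t) - h xs in
   (delta = 1 -> upper_bigO t0 hgap (fun t => 1 / ln t)) /\
   (delta < 1 -> upper_bigO t0 hgap (fun t => 1 / Rpower t (1 - delta)))).
Proof.
  destruct lambda_range as [lambda_pos lambda_lt].
  assert (lambda_delta : lambda * delta < 1).
  { apply Rlt_div_r in lambda_lt; [lra|exact delta_pos]. }
  assert (xs_zero : V xs = zero) by apply xs_opt.
  assert (rates : forall Theta rho T' L,
    (forall t, 0 < t -> is_derive Theta t (eps c delta t)) -> 0 <= L ->
    (forall t, T' <= t -> 1 <= rho t /\ Theta t <= L * rho t) ->
    bigO (fun t => norm (Phi V gradh c delta t (x t))) (fun t => sqrt (rho t / t)) /\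
    bigO (fun t => 1 / t * RInt (fun s : R => inner (minus (x s) xs) (V (x s))) t0 t)
      (fun t => rho t / t)).
  { intros Theta rho T' L hTheta hL hrho.
    destruct (dissipation_bound H h gradh V h_convex h_diff h_bounded_below V_cont
      V_monotone c delta t0 c_pos delta_pos t0_pos x x_sol xs xs_zero lambda
      lambda_pos lambda_delta Theta hTheta) as [T [C [K [_ [hC [hK hT]]]]]].
    exact (bigO_rates _ _ Theta rho T C K T' L hC hK hL (fun t => norm_ge_0 _) hT hrho). }
  assert (fast := fun hd : 1 < delta =>
    rates _ (fun _ => 1) 0 0
      (fun t => is_derive_power_primitive c delta t (Rgt_not_eq _ _ hd)) (Rle_refl 0)
      (fun t _ => conj (Rle_refl 1) (power_primitive_nonpos c delta t c_pos hd))).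
  assert (log_deriv : delta = 1 -> forall t, 0 < t ->
    is_derive (fun s => c * ln s) t (eps c delta t)).
  { intros hd. rewrite hd. apply is_derive_log_primitive. }
  assert (crit := fun hd : delta = 1 =>
    rates _ ln (exp 1) c (log_deriv hd) (Rlt_le _ _ c_pos)
      (fun t ht => conj (ln_ge_1 t ht) (Rle_refl (c * ln t)))).
  assert (slow := fun hd : delta < 1 =>
    rates _ (fun t => Rpower t (1 - delta)) 1 (c / (1 - delta))
      (fun t => is_derive_power_primitive c delta t (Rlt_not_eq _ _ hd))
      (Rdiv_le_0_compat _ _ (Rlt_le _ _ c_pos) (proj2 (Rlt_0_minus _ _) hd))
      (fun t ht => conj (Rpower_ge_1 t (1 - delta) ht (Rlt_le _ _ (proj2 (Rlt_0_minus _ _) hd)))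
        (Rle_refl _))).
  assert (value : forall Theta,
    (forall t, 0 < t -> is_derive Theta t (eps c delta t)) ->
    (forall M, exists T, forall t, T <= t -> M <= Theta t) ->
    exists T C, t0 < T /\ 0 <= C /\ forall t, T <= t ->
      0 < Theta t /\ h (xbest t) - h xs <= C / Theta t).
  { intros Theta hTheta hinf.
    exact (value_bound H h gradh V h_convex h_diff V_cont
      V_monotone c delta t0 c_pos delta_pos t0_pos x x_sol xs xs_zero lambda
      lambda_pos lambda_delta Theta hTheta xbest hinf xbest_argmin). }
  split; [now apply same_order_zeta2|]. split; [|split].
  - split; [|split].
    + intros hd. eapply bigO_ext; [|exact (proj1 (fast hd))].
      intros t ht. simpl. rewrite sqrt_div_alt, sqrt_1 by exact ht. reflexivity.
    + intros hd. exact (proj1 (crit hd)).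
    + intros hd. eapply bigO_ext; [|exact (proj1 (slow hd))].
      intros t ht. now apply sqrt_power_rate.
  - split; [|split].
    + intros hd. exact (proj2 (fast hd)).
    + intros hd. exact (proj2 (crit hd)).
    + intros hd. eapply bigO_ext; [|exact (proj2 (slow hd))].
      intros t ht. now apply power_rate.
  - split; intros hd.
    + destruct (value (fun t => c * ln t)) as [T [C [hT [hC hv]]]].
      * exact (log_deriv hd).
      * intros M. now apply log_primitive_infty.
      * exists (C / c), T. split; [apply Rdiv_le_0_compat; lra|].
        split; [exact hT|]. intros t ht. destruct (hv t ht) as [p b].
        assert (ln t <> 0) by nra.
        replace (C / c * (1 / ln t)) with (C / (c * ln t)) by (field; lra). exact b.
    + destruct (value (fun t => c / (1 - delta) * Rpower t (1 - delta)))
        as [T [C [hT [hC hv]]]].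
      * intros t. apply is_derive_power_primitive. lra.
      * intros M. now apply power_primitive_infty.
      * exists (C * (1 - delta) / c), T. split.
        { apply Rdiv_le_0_compat; [apply Rmult_le_pos; lra|exact c_pos]. }
        split; [exact hT|]. intros t ht. destruct (hv t ht) as [_ b].
        assert (p : 0 < Rpower t (1 - delta)) by apply exp_pos.
        replace (C * (1 - delta) / c * (1 / Rpower t (1 - delta)))
          with (C / (c / (1 - delta) * Rpower t (1 - delta))) by (field; lra).
        exact b.
Qed.
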